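(* Let $A\in\mathbb{R}_+^{m\times m}$ and let $I=I_m$ be the identity matrix. Let $V_1,\dots,V_k$ be the vertex sets of the strongly connected components of the digraph $\vec G(A)$. Then: (1) $\rho(A,I)=\rho(A)$, and there exists $\mathbf{y}\in\mathbb{R}^m_+\setminus\{\mathbf{0}\}$ with $A\mathbf{y}=\rho(A)\mathbf{y}$. (2) There exists $\mathbf{x}=(x_1,\dots,x_m)^\top>\mathbf{0}$ with $\rho(A)=\max_{i\in[m]}\frac{(A\mathbf{x})_i}{x_i}$ if and only if the following holds: for every $j\in[k]$ with $\rho(A[V_j])=\rho(A)$, the vertex $\{V_j\}$ is a sink of the reduced digraph $\vec G(A)_{red}$. (3) If $A$ is irreducible, then a vector $\mathbf{x}$ with positive coordinates summing to $1$ satisfying the condition in (2) is unique. (4) $\hat\rho(A,I)=\min\{\rho(A[V_i]):\ \{V_i\}\text{ is a source of }\vec G(A)_{red}\}$, and there exists $\mathbf{w}\in\mathbb{R}^m_+\setminus\{\mathbf{0}\}$ with $A\mathbf{w}=\hat\rho(A,I)\mathbf{w}$.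
   Context: $[m]=\{1,\dots,m\}$. For $A,B\in\mathbb{R}_+^{m\times n}$ and $\mathbf{x}\in\mathbb{R}^n_+\setminus\{\mathbf{0}\}$, $r(A,B,\mathbf{x})=\max_{i\in[m]}\frac{(A\mathbf{x})_i}{(B\mathbf{x})_i}\in[0,\infty]$ with the conventions $\frac00=0$, $\frac c0=\infty$ for $c>0$; $\rho(A,B)=\inf\{r(A,B,\mathbf{x}):\mathbf{x}>\mathbf{0}\}$ and $\hat\rho(A,B)=\inf\{r(A,B,\mathbf{x}):\mathbf{x}\in\mathbb{R}^n_+\setminus\{\mathbf{0}\}\}$. $\rho(M)$ denotes the spectral radius of a square matrix $M$. For $A=[a_{ij}]\in\mathbb{R}_+^{m\times m}$, the digraph $\vec G(A)$ has vertex set $[m]$ and a directed edge $(i,j)$ iff $a_{ij}>0$. A strongly connected component is a maximal vertex set $W$ such that the induced subdigraph is strongly connected (any single vertex, with or without a loop, lies in one; a one-vertex digraph counts as strongly connected). $A$ is irreducible if $\vec G(A)$ is strongly connected. For $U\subseteq[m]$, $A[U]=[a_{ij}]_{i,j\in U}$ is the principal submatrix. The reduced digraph $\vec G(A)_{red}$ has vertices $\{V_1\},\dots,\{V_k\}$ (the strongly connected components) and an edge from $\{V_i\}$ to $\{V_j\}$, $i\ne j$, iff some edge of $\vec G(A)$ goes from a vertex of $V_i$ to a vertex of $V_j$. A vertex $\{V_p\}$ is a source if no edge of $\vec G(A)_{red}$ enters it, and a sink if no edge of $\vec G(A)_{red}$ leaves it. *)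

(* Defs.v *)
(* The ambient field is an arbitrary numClosedFieldType C
   (e.g. the complex numbers); real numbers are its real elements. *)
From HB Require Import structures.
From mathcomp Require Import all_boot all_order all_algebra.
From Stdlib Require Import ClassicalEpsilon.
Set Implicit Arguments. Unset Strict Implicit. Unset Printing Implicit Defensive.
Import Order.TTheory GRing.Theory Num.Theory.
Local Open Scope ring_scope.

Section Defs.
Variable C : numClosedFieldType.

(* Extended nonnegative reals [0,oo]: Some v = v, None = +oo. *)
Definition lee (a b : option C) : bool :=
  match b, a with
  | None, _ => true
  | Some _, None => false
  | Some b', Some a' => a' <= b'
  end.

Definition maxe (a b : option C) : option C :=
  match a, b with
  | Some a', Some b' => Some (if a' <= b' then b' else a')
  | _, _ => None
  end.

Definition ratio (a b : C) : option C :=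
  if b == 0 then (if a == 0 then Some 0 else None) else Some (a / b).

(* r(A,B,x) = max_i (Ax)_i/(Bx)_i  (for m >= 1; all ratios are >= 0) *)
Definition rfun (m n : nat) (A B : 'M[C]_(m, n)) (x : 'cV[C]_n) : option C :=
  \big[maxe/Some 0]_(i < m) ratio ((A *m x) i 0) ((B *m x) i 0).

Definition is_infe (S : option C -> Prop) (v : option C) : Prop :=
  (forall s, S s -> lee v s) /\
  (forall w, (forall s, S s -> lee w s) -> lee w v).

Definition nonneg_mx (m n : nat) (A : 'M[C]_(m, n)) : Prop :=
  forall i j, 0 <= A i j.
Definition nonneg_vec (n : nat) (x : 'cV[C]_n) : Prop := forall i, 0 <= x i 0.
Definition pos_vec (n : nat) (x : 'cV[C]_n) : Prop := forall i, 0 < x i 0.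

Definition rho_set (m n : nat) (A B : 'M[C]_(m, n)) (s : option C) : Prop :=
  exists x, pos_vec x /\ rfun A B x = s.
Definition rhohat_set (m n : nat) (A B : 'M[C]_(m, n)) (s : option C) : Prop :=
  exists x, nonneg_vec x /\ x != 0 /\ rfun A B x = s.

Definition is_spec_rad (n : nat) (M : 'M[C]_n) (r : C) : Prop :=
  (exists l, eigenvalue M l /\ `|l| = r) /\
  (forall l, eigenvalue M l -> `|l| <= r).
Definition spec_rad (n : nat) (M : 'M[C]_n) : C :=
  epsilon (inhabits 0) (is_spec_rad M).

Definition psubmx (m : nat) (A : 'M[C]_m) (U : {set 'I_m}) : 'M[C]_#|U| :=
  \matrix_(i, j) A (enum_val i) (enum_val j).

Definition edge_in (m : nat) (A : 'M[C]_m) (W : {set 'I_m}) : rel 'I_m :=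
  [rel i j | (i \in W) && (j \in W) && (0 < A i j)].

Definition strongly_connected_on (m : nat) (A : 'M[C]_m) (W : {set 'I_m}) : Prop :=
  forall i j, i \in W -> j \in W -> connect (edge_in A W) i j.

Definition is_scc (m : nat) (A : 'M[C]_m) (W : {set 'I_m}) : Prop :=
  W != set0 /\ strongly_connected_on A W /\
  (forall W' : {set 'I_m}, W \subset W' -> strongly_connected_on A W' -> W' = W).

Definition irreducible_mx (m : nat) (A : 'M[C]_m) : Prop :=
  strongly_connected_on A setT.

Definition edge_between (m : nat) (A : 'M[C]_m) (V W : {set 'I_m}) : bool :=
  [exists i in V, exists j in W, 0 < A i j].

Definition is_sink (m : nat) (A : 'M[C]_m) (V : {set 'I_m}) : Prop :=
  forall W, is_scc A W -> W != V -> ~~ edge_between A V W.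
Definition is_source (m : nat) (A : 'M[C]_m) (V : {set 'I_m}) : Prop :=
  forall W, is_scc A W -> W != V -> ~~ edge_between A W V.

End Defs.

(* Main.v *)
(* The real elements of C form a real closed field that need not be archimedean,
   so the Perron vector is obtained algebraically instead of by compactness.
   Let p be the characteristic polynomial of A and h = p * adj(X - A) 1, so that
   (X - A) h = p^2 1.  Let r be the largest real root >= 0 of the product of the
   entries of h.  To the right of r all entries of h are positive, hence h(l) is
   a positive vector with A h(l) < l h(l), and this bounds every eigenvalue by l.
   At r itself p must vanish, since otherwise h(r) >= 0 and (r - A) h(r) > 0
   would force h(r) > 0.  Dividing h by the largest power of X - r gives a
   polynomial vector g with 0 <= g(r) != 0 and (r - A) g(r) = 0; thus r is the
   spectral radius.

   For irreducible blocks, pairing with a positive left Perron vector shows that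
   A x <= rho(A) x forces equality.  This gives uniqueness and excludes edges
   leaving a class of maximal spectral radius; conversely a supersolution is
   glued from Perron vectors on those classes and a large multiple of a strict
   supersolution on the remaining ones.  The support of any x >= 0 with
   A x <= s x is closed under predecessors, hence contains a source class. *)
Require Import Defs.
From HB Require Import structures.
From mathcomp Require Import all_boot all_order all_algebra.
From Stdlib Require Import ClassicalEpsilon.
Set Implicit Arguments.
Unset Strict Implicit.
Unset Printing Implicit Defensive.
Import Order.TTheory GRing.Theory Num.Theory.
Local Open Scope ring_scope.

(** * Sign of real polynomials *)

Lemma seq_real_max (C : numClosedFieldType) (s : seq C) :
  s != [::] -> (forall x, x \in s -> x \is Num.real) ->
  exists2 x, x \in s & forall y, y \in s -> y <= x.
Proof.
elim: s => // a s IH _ Hs; have [->|s0] := eqVneq s [::].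
  by exists a; rewrite ?mem_head // => y; rewrite inE => /eqP->.
have [y ys|x xs Hx] := IH s0; first by apply: Hs; rewrite inE ys orbT.
have [||ax|xa] := @real_leP _ a x; try by apply: Hs; rewrite inE ?eqxx ?xs ?orbT.
  by exists x; rewrite ?inE ?xs ?orbT // => y; rewrite inE => /orP[/eqP->|/Hx].
exists a; first by rewrite mem_head.
by move=> y; rewrite inE => /orP[/eqP->//|/Hx/le_trans]; apply; apply: ltW.
Qed.

Lemma fin_real_max (C : numClosedFieldType) (T : finType) (P : pred T)
    (f : T -> C) (i0 : T) :
  P i0 -> (forall i, f i \is Num.real) ->
  exists2 i, P i & forall j, P j -> f j <= f i.
Proof.
move=> Pi0 fr; have [||x] := @seq_real_max C [seq f i | i <- enum P].
- have : f i0 \in [seq f i | i <- enum P] by apply: map_f; rewrite mem_enum.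
  by case: [seq f i | i <- enum P].
- by move=> x /mapP[i _ ->].
move=> /mapP[i]; rewrite mem_enum => Pi -> Hi; exists i => // j Pj.
by apply: Hi; apply: map_f; rewrite mem_enum.
Qed.

Lemma fin_real_min (C : numClosedFieldType) (T : finType) (P : pred T)
    (f : T -> C) (i0 : T) :
  P i0 -> (forall i, f i \is Num.real) ->
  exists2 i, P i & forall j, P j -> f i <= f j.
Proof.
move=> Pi0 fr; have [|i Pi Hi] := @fin_real_max C T P (fun i => - f i) i0 Pi0.
  by move=> i; rewrite rpredN.
by exists i => // j /Hi; rewrite lerN2.
Qed.

(** Replaces a limit l -> r: if r < a, the midpoint of r and a contradicts the hypothesis. *)
Lemma real_le_forall_gt (C : numClosedFieldType) (a r : C) :
  a \is Num.real -> r \is Num.real -> (forall l, r < l -> a <= l) -> a <= r.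
Proof.
move=> ar rr H; case: (real_leP ar rr) => // /midf_lt[/H al la].
by have := le_lt_trans al la; rewrite ltxx.
Qed.

(** Invariance under conjugation lets reality pass through products, determinants and adjugates by
    morphism laws. *)
Definition real_poly (C : numClosedFieldType) (q : {poly C}) : Prop :=
  map_poly Num.conj q = q.

Lemma real_poly_horner (C : numClosedFieldType) (q : {poly C}) (x : C) :
  real_poly q -> x \is Num.real -> q.[x] \is Num.real.
Proof.
by move=> qr; rewrite !CrealE => /eqP xr; rewrite -horner_map /= xr qr.
Qed.

Lemma real_poly_XsubC (C : numClosedFieldType) (a : C) :
  a \is Num.real -> real_poly ('X - a%:P).
Proof.
by rewrite CrealE => /eqP ar; rewrite /real_poly rmorphB /= map_polyX map_polyC /= ar.
Qed.

Lemma real_polyM (C : numClosedFieldType) (p q : {poly C}) :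
  real_poly p -> real_poly q -> real_poly (p * q).
Proof. by rewrite /real_poly rmorphM /= => -> ->. Qed.

Lemma real_poly_cancel (C : numClosedFieldType) (p q : {poly C}) :
  q != 0 -> real_poly q -> real_poly (p * q) -> real_poly p.
Proof. by rewrite /real_poly rmorphM /= => q0 -> /(mulIf q0). Qed.

(* Factor out the real roots (each outside [a, b]) and the conjugate pairs of
   nonreal ones: every factor takes values of the same sign at a and b. *)
Lemma real_poly_same_sign (C : numClosedFieldType) (q : {poly C}) (a b : C) :
  real_poly q -> a \is Num.real -> b \is Num.real ->
  (forall x, a <= x -> x <= b -> q.[x] != 0) -> a <= b -> 0 < q.[a] * q.[b].
Proof.
move=> qr ar br nz ab; move: qr nz.
have [n] := ubnP (size q); elim: n q => // n IH q; rewrite ltnS => sq qr nz.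
have [s1|/closed_rootP[z]] := eqVneq (size q) 1%N.
  have /size_poly1P[c c0 qc] : size q == 1%N by apply/eqP.
  have := real_poly_horner qr ar; rewrite qc !hornerC => cr.
  by rewrite -expr2 -real_normK // exprn_gt0 // normr_gt0.
have q0 : q != 0 by apply: contraTneq (nz a (lexx _) ab) => ->; rewrite horner0 eqxx.
move=> rz; have /factor_theorem[q' qE] := rz.
have q'0 : q' != 0 by apply: contraNneq q0 => q'0; rewrite qE q'0 mul0r.
have sq' : (size q' < size q)%N.
  by rewrite qE size_mul ?polyXsubC_eq0 // size_XsubC addn2 /=.
have [zr|znr] := boolP (z \is Num.real).
  have q'r : real_poly q'.
    apply: (@real_poly_cancel _ _ ('X - z%:P)); rewrite ?polyXsubC_eq0 //.
      exact: real_poly_XsubC.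
    by rewrite -qE.
  have := IH q' (leq_trans sq' sq) q'r; rewrite qE !hornerM !hornerXsubC => /(_ _) H.
  have {}H : 0 < q'.[a] * q'.[b].
    apply: H => x ax xb; have := nz x ax xb; rewrite qE hornerM mulf_eq0 negb_or.
    by case/andP.
  rewrite mulrACA pmulr_rgt0 //.
  have [za|az] := real_ltP zr ar.
    by rewrite mulr_gt0 // subr_gt0 // (lt_le_trans za).
  have [bz|zb] := real_ltP br zr.
    by rewrite -mulrNN mulr_gt0 // oppr_gt0 subr_lt0 // (le_lt_trans ab).
  by have := nz z az zb; rewrite (rootP rz) eqxx.
have rz' : root q z^* by rewrite /root -qr horner_map (rootP rz) rmorph0.
have zz : z^* - z != 0 by rewrite subr_eq0 -CrealE.
have /factor_theorem[q'' q'E] : root q' z^*.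
  move: rz'; rewrite /root qE hornerM hornerXsubC mulf_eq0 (negPf zz) orbF.
  by [].
pose d := ('X - (z^*)%:P) * ('X - z%:P) : {poly C}.
have qd : q = q'' * d by rewrite qE q'E mulrA.
have dr : real_poly d.
  by rewrite /real_poly rmorphM !rmorphB /= !map_polyX !map_polyC /= conjCK mulrC.
have d0 : d != 0 by rewrite mulf_neq0 ?polyXsubC_eq0.
have dpos x : x \is Num.real -> 0 < d.[x].
  move=> xr; have -> : d.[x] = `|x - z| ^+ 2.
    rewrite hornerM !hornerXsubC normCK rmorphB /= mulrC; congr (_ * (_ - _)).
    by apply/esym/eqP; rewrite -CrealE.
  by rewrite exprn_gt0 // normr_gt0 subr_eq0; apply: contraNneq znr => <-.
have q''r : real_poly q''.
  by apply: real_poly_cancel d0 dr _; rewrite -qd.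
have sq'' : (size q'' <= size q')%N.
  have [->|q''0] := eqVneq q'' 0; first by rewrite size_poly0.
  by rewrite q'E size_mul ?polyXsubC_eq0 // size_XsubC addn2 /= leqW.
have H : 0 < q''.[a] * q''.[b].
  apply: IH => //; first exact: leq_ltn_trans sq'' (leq_trans sq' sq).
  move=> x ax xb; have := nz x ax xb; rewrite qd hornerM mulf_eq0 negb_or.
  by case/andP.
by rewrite qd !(hornerM q'') mulrACA pmulr_rgt0 // mulr_gt0 // dpos.
Qed.

Lemma gap_right (C : numClosedFieldType) (s : seq C) (a : C) :
  a \is Num.real ->
  exists2 b, a < b & forall x, a < x -> x <= b -> x \notin s.
Proof.
move=> ar; elim: s => [|z s [b ab Hb]]; first by exists (a + 1); rewrite ?ltrDl.
(* [z] may be nonreal and incomparable with [a]; it then never lies above [a], and [b] is kept. *)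
have [az|naz] := boolP (a < z); last first.
  exists b => // x ax xb; rewrite inE negb_or Hb // andbT.
  by apply: contraNneq naz => <-.
have [m1 m2] := midf_lt az; set c := (a + z) / 2 in m1 m2.
have br : b \is Num.real by rewrite -(subrK a b) rpredD // gtr0_real // subr_gt0.
have cr : c \is Num.real by rewrite -(subrK a c) rpredD // gtr0_real // subr_gt0.
have [bc|cb] := real_leP br cr.
  exists b => // x ax xb; rewrite inE negb_or Hb // andbT.
  by rewrite lt_eqF // (le_lt_trans xb) // (le_lt_trans bc).
exists c => // x ax xc; rewrite inE negb_or Hb // ?andbT.
  by rewrite lt_eqF // (le_lt_trans xc).
by rewrite (le_trans xc) // ltW.
Qed.

Lemma poly_roots_seq (C : numClosedFieldType) (q : {poly C}) :
  q != 0 -> exists s : seq C, forall x, root q x = (x \in s).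
Proof.
move=> q0; have [s ->] := closed_field_poly_normal q; exists s => x.
by rewrite rootZ ?lead_coef_eq0 // root_prod_XsubC.
Qed.

(** A sign argument in place of continuity: if q(a) < 0, finiteness of the roots leaves some [a, b]
    free of them, so q(b) < 0 too. *)
Lemma real_poly_ge0_right (C : numClosedFieldType) (q : {poly C}) (a : C) :
  real_poly q -> a \is Num.real -> (forall l, a < l -> 0 <= q.[l]) -> 0 <= q.[a].
Proof.
move=> qr ar H; have [//|qa] := real_leP (@real0 _) (real_poly_horner qr ar).
have q0 : q != 0 by apply: contraTneq qa => ->; rewrite horner0 ltxx.
have [s Hs] := poly_roots_seq q0; have [b ab Hb] := gap_right s ar.
have br : b \is Num.real by rewrite -(subrK a b) rpredD // gtr0_real // subr_gt0.
suff nz x : a <= x -> x <= b -> q.[x] != 0.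
  have := @real_poly_same_sign _ q a b qr ar br nz (ltW ab).
  by rewrite nmulr_rgt0 // (le_gtF (H b ab)).
rewrite le_eqVlt => /orP[/eqP<- _|ax xb]; first by rewrite lt_eqF.
by have := Hb _ ax xb; rewrite -Hs /root.
Qed.

(** While all entries vanish at a, a factor X - a is taken out of each; the size of the nonzero
    [h i0] bounds how often. *)
Lemma poly_vec_factor (C : numClosedFieldType) (T : finType)
    (h : T -> {poly C}) (a : C) (i0 : T) :
  h i0 != 0 ->
  exists k (g : T -> {poly C}),
    (forall i, h i = g i * ('X - a%:P) ^+ k) /\ exists i, (g i).[a] != 0.
Proof.
have [n] := ubnP (size (h i0)); elim: n h => // n IH h; rewrite ltnS => sh h0.
have [/existsP[i hi]|/existsPn H] := boolP [exists i, (h i).[a] != 0].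
  by exists 0%N, h; split=> [j|]; [rewrite expr0 mulr1 | exists i].
have /fin_all_exists[g gE] : forall i, exists q, h i = q * ('X - a%:P).
  by move=> i; apply/factor_theorem; have := H i; rewrite negbK.
have g0 : g i0 != 0 by apply: contraNneq h0 => g0; rewrite gE g0 mul0r.
have [|k [f [fE fi]]] := IH g _ g0.
  by move: sh; rewrite gE size_mul ?polyXsubC_eq0 // size_XsubC addn2 /=.
by exists k.+1, f; split=> // i; rewrite gE fE exprSr mulrA.
Qed.

(** * Supersolutions and the Perron vector *)

Lemma mulmx_colE (R : pzRingType) (m n : nat) (A : 'M[R]_(m, n))
    (x : 'cV[R]_n) (i : 'I_m) : (A *m x) i 0 = \sum_j A i j * x j 0.
Proof. by rewrite mxE. Qed.

Lemma nonneg_mulmx (C : numClosedFieldType) (m n : nat) (A : 'M[C]_(m, n))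
    (x : 'cV[C]_n) : nonneg_mx A -> nonneg_vec x -> nonneg_vec (A *m x).
Proof. by move=> HA Hx i; rewrite mxE sumr_ge0 // => j _; apply: mulr_ge0. Qed.

(** [eigenvalue] refers to row vectors; a column eigenvector also prevents A - l from being
    invertible. *)
Lemma eigenvalue_col (F : fieldType) (n : nat) (A : 'M[F]_n) (l : F)
    (y : 'cV[F]_n) : y != 0 -> A *m y = l *: y -> eigenvalue A l.
Proof.
move=> y0 Ay; rewrite /eigenvalue kermx_eq0 row_free_unit; apply/negP => U.
move: y0; rewrite -[y](mulKmx U) mulmxBl Ay mul_scalar_mx subrr mulmx0 eqxx.
by [].
Qed.

Lemma eigenvalue_trmx (F : fieldType) (n : nat) (A : 'M[F]_n) (l : F) :
  eigenvalue A^T l = eigenvalue A l.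
Proof.
rewrite /eigenvalue !kermx_eq0 !row_free_unit -unitmx_tr linearB /=.
by rewrite trmxK tr_scalar_mx.
Qed.

(** For a left eigenvector u, with |u| taken entrywise, |l| |u| x <= |u| A x <= r |u| x, and |u| x >
    0. *)
Lemma eigenvalue_le_supersolution (C : numClosedFieldType) (n : nat)
    (A : 'M[C]_n) (x : 'cV[C]_n) (r l : C) :
  nonneg_mx A -> pos_vec x -> (forall i, (A *m x) i 0 <= r * x i 0) ->
  eigenvalue A l -> `|l| <= r.
Proof.
move=> HA Hx Hr /eigenvalueP[u uA u0].
have [k uk] : exists k, u 0 k != 0.
  apply/existsP; apply: contraNT u0 => /existsPn H; apply/eqP/rowP => k.
  by rewrite mxE; apply/eqP; have := H k; rewrite negbK.
have Sp : 0 < \sum_i `|u 0 i| * x i 0.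
  rewrite (bigD1 k) //= ltr_pwDl // ?mulr_gt0 ?normr_gt0 //.
  by apply: sumr_ge0 => i _; rewrite mulr_ge0 // ltW.
rewrite -(ler_pM2r Sp) mulr_sumr.
apply: (@le_trans _ _ (\sum_j \sum_i `|u 0 i| * (A i j * x j 0))).
  apply: ler_sum => j _; rewrite mulrA -normrM.
  have -> : l * u 0 j = \sum_i u 0 i * A i j.
    by have /rowP/(_ j) := uA; rewrite !mxE.
  under [leRHS]eq_bigr => i _ do rewrite mulrA.
  rewrite -mulr_suml ler_pM2r //.
  apply: le_trans (ler_norm_sum _ _ _) _.
  by apply: ler_sum => i _; rewrite normrM (ger0_norm (HA _ _)).
rewrite exchange_big /= mulr_sumr; apply: ler_sum => i _.
rewrite -mulr_sumr mulrCA ler_wpM2l //.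
by have := Hr i; rewrite mulmx_colE.
Qed.

Definition strict_super (C : numClosedFieldType) (n : nat) (A : 'M[C]_n) (l : C)
    (x : 'cV[C]_n) : Prop :=
  pos_vec x /\ forall i, (A *m x) i 0 < l * x i 0.

(** The largest ratio (A x)_i / x_i is still < r and satisfies the weak bound. *)
Lemma strict_super_eigenvalue (C : numClosedFieldType) (n : nat)
    (A : 'M[C]_n) (x : 'cV[C]_n) (r l : C) : (0 < n)%N ->
  nonneg_mx A -> strict_super A r x -> eigenvalue A l -> `|l| < r.
Proof.
move=> n0 HA [Hx Hr] el; pose f i := (A *m x) i 0 / x i 0.
have fr i : f i \is Num.real.
  by rewrite ger0_real // divr_ge0 ?nonneg_mulmx //; try move=> j; apply: ltW.
have [i _ Hi] := @fin_real_max C _ xpredT f (Ordinal n0) isT fr.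
apply: (@le_lt_trans _ _ (f i)); last by rewrite /f ltr_pdivrMr.
apply: (eigenvalue_le_supersolution HA Hx _ el) => j.
by rewrite -ler_pdivrMr //; exact: (Hi j isT).
Qed.

(* At an index minimizing v / x, with minimum t < 0, the nonnegativity of
   A (v - t x) contradicts strictness. *)
Lemma strict_super_monotone (C : numClosedFieldType) (n : nat)
    (A : 'M[C]_n) (x v : 'cV[C]_n) (r : C) :
  nonneg_mx A -> strict_super A r x ->
  (forall i, v i 0 \is Num.real) -> (forall i, (A *m v) i 0 <= r * v i 0) ->
  nonneg_vec v.
Proof.
move=> HA [Hx Hr] vr Hv k.
have fr i : v i 0 / x i 0 \is Num.real.
  by rewrite rpred_div // gtr0_real.
have [i _ Hi] := @fin_real_min C _ xpredT (fun i => v i 0 / x i 0) k isT fr.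
set t := v i 0 / x i 0 in Hi *.
have vi : v i 0 = t * x i 0 by rewrite /t divfK // gt_eqF.
have [t0|t0] := real_leP (@real0 C) (fr i).
  have := le_trans t0 (Hi k isT).
  by rewrite -{1}(mul0r (x k 0)^-1) ler_pM2r // invr_gt0.
have Aw : 0 <= (A *m (v - t *: x)) i 0.
  apply: nonneg_mulmx => // j; rewrite !mxE subr_ge0 -ler_pdivlMr //.
  exact: Hi.
rewrite mulmxBr -scalemxAr !mxE subr_ge0 -!mulmx_colE in Aw.
have := le_trans Aw (Hv i); rewrite vi mulrCA ler_nM2l //.
by rewrite (lt_geF (Hr i)).
Qed.

Lemma pos_of_nonneg_super (C : numClosedFieldType) (n : nat)
    (A : 'M[C]_n) (x : 'cV[C]_n) (r : C) :
  nonneg_mx A -> nonneg_vec x -> (forall i, (A *m x) i 0 < r * x i 0) ->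
  strict_super A r x.
Proof.
move=> HA Hx Hr; split=> // i; rewrite lt_def Hx andbT.
apply: contraTneq (Hr i) => ->; rewrite mulr0 le_gtF //.
exact: nonneg_mulmx.
Qed.

(* p^2 times (X - A)^-1 1, which has the sign of the resolvent vector at every
   real non-eigenvalue, whatever the sign of p. *)
Definition resolvent_vec (C : numClosedFieldType) (n : nat) (A : 'M[C]_n)
    (i : 'I_n) : {poly C} :=
  (char_poly A *: (\adj (char_poly_mx A) *m const_mx 1 : 'cV_n)) i 0.

(** X - A times its adjugate is p times the identity; the extra factor p in [resolvent_vec] makes
    the right-hand side a square. *)
Lemma resolvent_vecE (C : numClosedFieldType) (n : nat) (A : 'M[C]_n) (i : 'I_n) :
  'X * resolvent_vec A i - \sum_j (A i j)%:P * resolvent_vec A j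
    = char_poly A ^+ 2.
Proof.
pose h := char_poly A *: (\adj (char_poly_mx A) *m const_mx 1 : 'cV_n).
have /colP/(_ i) : char_poly_mx A *m h = const_mx (char_poly A ^+ 2).
  rewrite -scalemxAr mulmxA mul_mx_adj mul_scalar_mx scalerA.
  by apply/colP => j; rewrite !mxE mulr1.
rewrite /char_poly_mx mulmxBl mul_scalar_mx [RHS]mxE => <-.
rewrite [RHS]mxE [in RHS]mxE; congr (_ + _); rewrite mxE; congr (- _).
by rewrite mulmx_colE; apply: eq_bigr => j _; rewrite [in RHS]mxE.
Qed.

Lemma resolvent_vec_real (C : numClosedFieldType) (n : nat) (A : 'M[C]_n) (i : 'I_n) :
  nonneg_mx A -> real_poly (resolvent_vec A i).
Proof.
move=> HA; have Ac : map_mx Num.conj A = A.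
  by apply/matrixP => a b; rewrite mxE; apply/eqP; rewrite -CrealE ger0_real.
rewrite /real_poly /resolvent_vec.
set h := (_ *: _); suff /matrixP/(_ i 0) : map_mx (map_poly Num.conj) h = h.
  by rewrite mxE.
rewrite map_mxZ map_mxM /= map_mx_adj /= map_char_poly_mx map_char_poly /= Ac.
by congr (_ *: (_ *m _)); apply/colP => j; rewrite !mxE rmorph1.
Qed.

Lemma horner_char_eqn (C : numClosedFieldType) (n : nat) (A : 'M[C]_n)
    (g : 'I_n -> {poly C}) (i : 'I_n) (l : C) :
  ('X * g i - \sum_j (A i j)%:P * g j).[l] =
  l * (g i).[l] - (A *m \col_j (g j).[l]) i 0.
Proof.
rewrite hornerD hornerN hornerM hornerX horner_sum mxE; congr (_ - _).
by apply: eq_bigr => j _; rewrite hornerM hornerC mxE.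
Qed.

(** The strict supersolutions at every l > r bound the eigenvalues by r and later show that no
    number above r is a lower bound for the ratios. *)
Lemma perron (C : numClosedFieldType) (n : nat) (A : 'M[C]_n) :
  (0 < n)%N -> nonneg_mx A ->
  exists (r : C) (y : 'cV[C]_n),
    [/\ 0 <= r, nonneg_vec y, y != 0, A *m y = r *: y &
        forall l, r < l -> exists x, strict_super A l x].
Proof.
move=> n0 HA; pose i0 := Ordinal n0.
pose h := resolvent_vec A; pose p := char_poly A.
pose hv l : 'cV[C]_n := \col_j (h j).[l].
have hr i : real_poly (h i) := resolvent_vec_real i HA.
have pr : real_poly p.
  rewrite /real_poly map_char_poly; congr char_poly.
  by apply/matrixP => a b; rewrite mxE; apply/eqP; rewrite -CrealE ger0_real.
have hE l i : l * (hv l) i 0 - (A *m hv l) i 0 = p.[l] ^+ 2.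
  have := congr1 (horner^~ l) (resolvent_vecE A i).
  by rewrite /= horner_char_eqn horner_exp [(hv l) i 0]mxE.
have p2 l : l \is Num.real -> p.[l] != 0 -> 0 < p.[l] ^+ 2.
  move=> lr pl; rewrite -real_normK ?real_poly_horner //.
  by rewrite exprn_gt0 // normr_gt0.
have pNroot l x : strict_super A l x -> p.[l] != 0.
  move=> Hx; apply/negP => p0.
  have el : eigenvalue A l by rewrite eigenvalue_root_char.
  have ll := strict_super_eigenvalue n0 HA Hx el.
  have lr : 0 <= l by rewrite ltW // (le_lt_trans _ ll).
  by move: ll; rewrite ger0_norm // ltxx.
have good_nonneg l : l \is Num.real -> p.[l] != 0 -> nonneg_vec (hv l) ->
    strict_super A l (hv l).
  move=> lr pl H; apply: pos_of_nonneg_super => // i.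
  by rewrite -subr_gt0 hE p2.
have super_pos l x : l \is Num.real -> strict_super A l x ->
    forall i, 0 < (h i).[l].
  move=> lr Hx i; have pl := pNroot _ _ Hx.
  suff [/(_ i)] : strict_super A l (hv l) by rewrite mxE.
  apply: good_nonneg => //.
  apply: (strict_super_monotone HA Hx) => j; first by rewrite mxE real_poly_horner.
  by rewrite -subr_ge0 hE ltW // p2.
(* [L] exceeds every row sum, so the all-ones vector is a strict supersolution from [L] on. *)
pose L := 1 + \sum_i \sum_j A i j.
have L1 : 1 <= L.
  by rewrite lerDl sumr_ge0 // => i _; rewrite sumr_ge0.
have big_super l : L <= l -> strict_super A l (const_mx 1).
  move=> Ll; split=> [i|i]; rewrite !mxE // mulr1 (lt_le_trans _ Ll) // /L.
  under eq_bigr => j _ do rewrite mxE mulr1.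
  rewrite ltr_pwDl // [leRHS](bigD1 i) //= lerDl sumr_ge0 // => k _.
  by rewrite sumr_ge0.
have big_pos l i : L <= l -> 0 < (h i).[l].
  move=> Ll; apply: super_pos (big_super _ Ll) i.
  by rewrite ger0_real // (le_trans _ Ll) // (le_trans _ L1).
pose P := \prod_i h i.
have PE x : P.[x] = \prod_i (h i).[x] by rewrite horner_prod.
have P0 : P != 0.
  have : 0 < P.[L] by rewrite PE; apply: prodr_gt0 => i _; apply: big_pos.
  by apply: contraTneq => ->; rewrite horner0 ltxx.
have [s Hs] := poly_roots_seq P0.
pose s' := [seq x <- s | 0 <= x].
(* With no root to the right of a, each entry has at a the sign it has at a point beyond [L]. *)
have right_pos a : 0 <= a -> (forall x, a <= x -> P.[x] != 0) ->
    forall i, 0 < (h i).[a].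
  move=> a0 Ha i; have ar := ger0_real a0.
  have [b [ab Lb]] : exists b, a <= b /\ L <= b.
    exists (a + L); rewrite lerDl lerDr a0; split=> //.
    by apply: le_trans L1.
  have br : b \is Num.real by rewrite ger0_real // (le_trans a0).
  have hb := big_pos _ i Lb.
  rewrite -(pmulr_lgt0 _ hb); apply: real_poly_same_sign => // x ax _.
  have := Ha x ax; rewrite PE; apply: contraNneq => hx.
  by rewrite (bigD1 i) //= hx mul0r.
(* Otherwise h(0) > 0 and -A h(0) = p(0)^2 is both <= 0 and > 0; p(0) is nonzero because p divides
   every entry of h. *)
have s'0 : s' != [::].
  apply/negP => /eqP s'0.
  have NP x : 0 <= x -> P.[x] != 0.
    move=> x0; apply/negP => Px; have : x \in s' by rewrite mem_filter x0 -Hs.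
    by rewrite s'0.
  have hp := right_pos 0 (lexx _) NP.
  have : p.[0] ^+ 2 <= 0.
    rewrite -(hE 0 i0) mul0r sub0r oppr_le0; apply: nonneg_mulmx => // j.
    by rewrite mxE ltW.
  rewrite lt_geF // p2 ?real0 //.
  have := hp i0; apply: contraTneq => p0.
  by rewrite /h /resolvent_vec mxE hornerM -/p p0 mul0r ltxx.
have [|r rs rmax] := seq_real_max s'0.
  by move=> x; rewrite mem_filter => /andP[/ger0_real].
have [r0 Pr] : 0 <= r /\ P.[r] = 0.
  by move: rs; rewrite mem_filter -Hs => /andP[? /rootP].
have rr := ger0_real r0.
have hpos l i : r < l -> 0 < (h i).[l].
  move=> rl; apply: right_pos; first by apply: le_trans r0 (ltW rl).
  move=> x lx; apply/negP => Px.
  have : x \in s'.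
    by rewrite mem_filter -Hs /root Px andbT (le_trans r0) // (le_trans (ltW rl)).
  by move/rmax; rewrite lt_geF // (lt_le_trans rl).
have lreal l : r < l -> l \is Num.real.
  by move=> rl; rewrite ger0_real // (le_trans r0) // ltW.
have pgt l : r < l -> p.[l] != 0.
  move=> rl; apply: contraTneq (hpos l i0 rl) => p0.
  by rewrite /h /resolvent_vec mxE hornerM -/p p0 mul0r ltxx.
have pr0 : p.[r] = 0.
  apply/eqP/negPn/negP => pr0.
  have [H _] : strict_super A r (hv r).
    apply: good_nonneg => // j; rewrite mxE; apply: real_poly_ge0_right => // l.
    by move/hpos => /(_ j)/ltW.
  have : 0 < P.[r].
    by rewrite PE; apply: prodr_gt0 => j _; have := H j; rewrite mxE.
  by rewrite Pr ltxx.
have h0 : h i0 != 0.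
  by apply: contraTneq (big_pos L i0 (lexx _)) => ->; rewrite horner0 ltxx.
have [k [g [gE [j0 gj0]]]] := @poly_vec_factor C _ h r i0 h0.
have X0 : ('X - r%:P) ^+ k != 0 by rewrite expf_neq0 // polyXsubC_eq0.
have Xr : real_poly (('X - r%:P) ^+ k).
  elim: (k) => [|k' IH]; first by rewrite expr0 /real_poly rmorph1.
  by rewrite exprS; apply: real_polyM => //; apply: real_poly_XsubC.
have gr i : real_poly (g i) by apply: real_poly_cancel X0 Xr _; rewrite -gE.
have Xpos l : r < l -> 0 < (('X - r%:P) ^+ k).[l].
  by move=> rl; rewrite horner_exp hornerXsubC exprn_gt0 // subr_gt0.
have g0 i : 0 <= (g i).[r].
  apply: real_poly_ge0_right => // l rl.
  by rewrite -(pmulr_lge0 _ (Xpos l rl)) -hornerM -gE ltW // hpos.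
(* [S] is (X - A) g. Cancelling the power of X - r shows that all its entries coincide, so (r - A)
   g(r) is a constant vector. *)
pose S i := 'X * g i - \sum_j (A i j)%:P * g j.
have SE i : S i * ('X - r%:P) ^+ k = p ^+ 2.
  rewrite -(resolvent_vecE A i) -/h gE mulrBl mulr_suml mulrA; congr (_ - _).
  by apply: eq_bigr => j _; rewrite gE mulrA.
have Sij i : S i = S i0 by apply: (mulIf X0); rewrite !SE.
have Sr : real_poly (S i0).
  apply: real_poly_cancel X0 Xr _; rewrite SE expr2; exact: real_polyM.
have S0 : 0 <= (S i0).[r].
  apply: real_poly_ge0_right => // l rl.
  by rewrite -(pmulr_lge0 _ (Xpos l rl)) -hornerM SE horner_exp ltW // p2 ?lreal ?pgt.
pose y : 'cV[C]_n := \col_j (g j).[r].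
have y0 : nonneg_vec y by move=> i; rewrite mxE.
have SyE i : r * y i 0 - (A *m y) i 0 = (S i0).[r].
  by rewrite -(Sij i) horner_char_eqn mxE.
(* A positive value would make g(r) a strict supersolution at r, which [pNroot] excludes since p(r)
   = 0. *)
have Sr0 : (S i0).[r] = 0.
  apply/eqP/negPn/negP => Sn; suff /pNroot : strict_super A r y.
    by rewrite pr0 eqxx.
  by apply: pos_of_nonneg_super => // i; rewrite -subr_gt0 SyE lt_def Sn.
exists r, y; split=> //.
- by apply: contraNneq gj0 => /colP/(_ j0); rewrite !mxE => ->.
- apply/colP => i; rewrite [RHS]mxE; apply/esym/eqP.
  by rewrite -subr_eq0 SyE Sr0.
move=> l rl; exists (hv l); apply: good_nonneg; rewrite ?lreal ?pgt // => j.
by rewrite mxE ltW // hpos.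
Qed.

(** * Irreducible matrices, principal submatrices and components *)

(** [spec_rad] is a choice; any two candidates bound each other. *)
Lemma spec_rad_unique (C : numClosedFieldType) (n : nat) (M : 'M[C]_n) (r : C) :
  is_spec_rad M r -> spec_rad M = r.
Proof.
move=> Mr; have := epsilon_spec (inhabits 0) (is_spec_rad M) (ex_intro _ r Mr).
rewrite -/(spec_rad M); case: Mr => [[l [el <-]] Hl] [[l' [el' <-]] Hl'].
by apply/le_anti; rewrite Hl // Hl'.
Qed.

Lemma spec_rad_perron (C : numClosedFieldType) (n : nat) (A : 'M[C]_n) :
  (0 < n)%N -> nonneg_mx A ->
  [/\ is_spec_rad A (spec_rad A), 0 <= spec_rad A,
      exists y : 'cV[C]_n,
        [/\ nonneg_vec y, y != 0 & A *m y = spec_rad A *: y] &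
      forall l, spec_rad A < l -> exists x, strict_super A l x].
Proof.
move=> n0 HA; have [r [y [r0 y0 yn Ay Hr]]] := perron n0 HA.
have rP : is_spec_rad A r.
  split; first by exists r; rewrite ger0_norm // (eigenvalue_col yn Ay).
  move=> l el; apply: real_le_forall_gt; rewrite ?normr_real ?ger0_real // => t.
  by case/Hr=> x Hx; apply/ltW/(strict_super_eigenvalue n0 HA Hx el).
by rewrite (spec_rad_unique rP); split=> //; exists y.
Qed.

Lemma spec_rad_ge0 (C : numClosedFieldType) (n : nat) (A : 'M[C]_n) :
  (0 < n)%N -> nonneg_mx A -> 0 <= spec_rad A.
Proof. by move=> n0 HA; have [] := spec_rad_perron n0 HA. Qed.

Lemma spec_rad_le_super (C : numClosedFieldType) (n : nat) (A : 'M[C]_n)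
    (x : 'cV[C]_n) (r : C) : (0 < n)%N -> nonneg_mx A ->
  pos_vec x -> (forall i, (A *m x) i 0 <= r * x i 0) -> spec_rad A <= r.
Proof.
move=> n0 HA Hx Hr; have [[[l [el <-]] _] _ _ _] := spec_rad_perron n0 HA.
exact: (eigenvalue_le_supersolution HA Hx Hr el).
Qed.

Lemma eigenvalue_le_spec_rad (C : numClosedFieldType) (n : nat) (A : 'M[C]_n)
    (y : 'cV[C]_n) (r : C) : (0 < n)%N -> nonneg_mx A ->
  0 <= r -> y != 0 -> A *m y = r *: y -> r <= spec_rad A.
Proof.
move=> n0 HA r0 y0 Ay; have [[_ H] _ _ _] := spec_rad_perron n0 HA.
by rewrite -(ger0_norm r0) H // (eigenvalue_col y0 Ay).
Qed.

Lemma spec_rad_trmx (C : numClosedFieldType) (n : nat) (A : 'M[C]_n) :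
  (0 < n)%N -> nonneg_mx A -> spec_rad A^T = spec_rad A.
Proof.
move=> n0 HA; apply: spec_rad_unique; have [[[l [el lA]] H] _ _ _] := spec_rad_perron n0 HA.
split; first by exists l; rewrite eigenvalue_trmx.
by move=> t; rewrite eigenvalue_trmx => /H.
Qed.

(** Irreducibility phrased by closed sets rather than paths, the form suited to supports of
    supersolutions. *)
Definition pred_closed_trivial (C : numClosedFieldType) (n : nat) (B : 'M[C]_n) :=
  forall Y : {set 'I_n}, Y != set0 ->
    (forall i j, j \in Y -> 0 < B i j -> i \in Y) -> Y = setT.

(** The complement of a set closed under predecessors for [B^T] is closed under predecessors for
    [B]. *)
Lemma pred_closed_trivial_tr (C : numClosedFieldType) (n : nat) (B : 'M[C]_n) :
  pred_closed_trivial B -> pred_closed_trivial B^T.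
Proof.
move=> HB Y Y0 Yc; apply/eqP/negPn/negP => YT.
have : ~: Y = setT.
  apply: HB => [|i j]; first by rewrite -setCT (inj_eq (@setC_inj _)).
  rewrite !inE => jY Bij; apply: contra jY => iY.
  by apply: (Yc _ _ iY); rewrite mxE.
by move/(congr1 (@setC _)); rewrite setCK setCT; apply/eqP.
Qed.

(** If x_i = 0 then (B x)_i <= 0, yet its term B_ij x_j is positive. Supports are thus closed under
    predecessors. *)
Lemma nonneg_super_support (C : numClosedFieldType) (n : nat) (B : 'M[C]_n)
    (x : 'cV[C]_n) (r : C) (i j : 'I_n) : nonneg_mx B -> nonneg_vec x ->
  (forall i, (B *m x) i 0 <= r * x i 0) ->
  0 < B i j -> x j 0 != 0 -> x i 0 != 0.
Proof.
move=> HB Hx Hr Bij xj; apply: contraTneq (Hr i) => ->; rewrite mulr0 mulmx_colE.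
rewrite lt_geF // (bigD1 j) //= ltr_pwDl // ?mulr_gt0 // ?lt_def ?xj ?Hx //.
by apply: sumr_ge0 => k _; apply: mulr_ge0.
Qed.

Lemma irreducible_super_pos (C : numClosedFieldType) (n : nat) (B : 'M[C]_n)
    (x : 'cV[C]_n) (r : C) : nonneg_mx B -> pred_closed_trivial B ->
  nonneg_vec x -> x != 0 -> (forall i, (B *m x) i 0 <= r * x i 0) -> pos_vec x.
Proof.
move=> HB irr Hx x0 Hr i; rewrite lt_def Hx andbT.
have /setP/(_ i) : [set i | x i 0 != 0] = setT.
  apply: irr => [|a b]; rewrite ?inE.
    apply: contraNneq x0 => /setP Y0; apply/eqP/colP => k; rewrite mxE.
    by have := Y0 k; rewrite !inE => /negbFE/eqP.
  by move=> xb Bab; apply: (nonneg_super_support HB Hx Hr Bab xb).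
by rewrite !inE.
Qed.

(* Pair r x - B x >= 0 with the positive left Perron vector of B: the result is 0. *)
Lemma irreducible_super_eq (C : numClosedFieldType) (n : nat) (B : 'M[C]_n)
    (x : 'cV[C]_n) : (0 < n)%N -> nonneg_mx B -> pred_closed_trivial B ->
  (forall i, (B *m x) i 0 <= spec_rad B * x i 0) -> B *m x = spec_rad B *: x.
Proof.
move=> n0 HB irr Hr.
have HBt : nonneg_mx B^T by move=> i j; rewrite mxE.
have [_ _ [u [u0 un Bu]] _] := spec_rad_perron n0 HBt.
rewrite spec_rad_trmx // in Bu.
have up : pos_vec u.
  apply: (irreducible_super_pos HBt (pred_closed_trivial_tr irr) u0 un) => i.
  by rewrite Bu mxE; apply: lexx.
have uB : u^T *m B = spec_rad B *: u^T.
  by rewrite -[LHS]trmxK trmx_mul trmxK Bu linearZ.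
pose d := spec_rad B *: x - B *m x.
have d0 i : 0 <= u i 0 * d i 0.
  by rewrite mulr_ge0 // !mxE subr_ge0 -mulmx_colE.
have : \sum_i u i 0 * d i 0 == 0.
  have -> : \sum_i u i 0 * d i 0 = (u^T *m d) 0 0.
    by rewrite [RHS]mxE; apply: eq_bigr => i _; rewrite [u^T _ _]mxE.
  by rewrite mulmxBr mulmxA uB -scalemxAr -scalemxAl subrr mxE.
rewrite psumr_eq0 // => /allP H; apply/colP => i; apply/esym/eqP.
have := H i (mem_index_enum _); rewrite /= mulf_eq0 gt_eqF //=.
by rewrite !mxE subr_eq0.
Qed.

(** For the largest t with x1 - t x2 >= 0 the difference has a zero entry, whereas a nonzero
    nonnegative eigenvector would be positive. *)
Lemma irreducible_eigenvector_unique (C : numClosedFieldType) (n : nat)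
    (B : 'M[C]_n) (r : C) (x1 x2 : 'cV[C]_n) : (0 < n)%N ->
  nonneg_mx B -> pred_closed_trivial B -> pos_vec x1 -> pos_vec x2 ->
  B *m x1 = r *: x1 -> B *m x2 = r *: x2 -> exists t, x1 = t *: x2.
Proof.
move=> n0 HB irr H1 H2 B1 B2.
have fr i : x1 i 0 / x2 i 0 \is Num.real by rewrite ger0_real // divr_ge0 // ltW.
have [i _ Hi] := @fin_real_min C _ xpredT (fun i => x1 i 0 / x2 i 0)
  (Ordinal n0) isT fr.
set t := x1 i 0 / x2 i 0 in Hi; exists t; apply/eqP; rewrite -subr_eq0.
apply/negPn/negP => d0.
have dn : nonneg_vec (x1 - t *: x2).
  by move=> j; rewrite !mxE subr_ge0 -ler_pdivlMr //; apply: (Hi j).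
have /(_ i) : pos_vec (x1 - t *: x2).
  apply: (irreducible_super_pos (r := r) HB irr dn d0) => j.
  by rewrite mulmxBr -scalemxAr B1 B2 scalerA mulrC -scalerA -scalerBr mxE.
by rewrite !mxE /t divfK ?subrr ?ltxx // gt_eqF.
Qed.

(** * Restriction to a vertex set and extension by zero *)

Definition restrict_vec (C : numClosedFieldType) (m : nat) (U : {set 'I_m})
    (x : 'cV[C]_m) : 'cV[C]_#|U| := \col_k x (enum_val k) 0.

Lemma pad_vec (C : numClosedFieldType) (m : nat) (U : {set 'I_m})
    (z : 'cV[C]_#|U|) :
  exists2 x : 'cV[C]_m, restrict_vec U x = z & forall i, i \notin U -> x i 0 = 0.
Proof.
(* As [enum_val] is injective with values in [U], the sum has one term on [U] and none outside. *)
exists (\col_i \sum_(k | enum_val k == i) z k 0) => [|i iU].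
  apply/colP => k; rewrite !mxE (bigD1 k) //= big1 ?addr0 // => j.
  by rewrite (inj_eq enum_val_inj) => /andP[->].
rewrite mxE big1 // => k /eqP ik; move: iU; rewrite -ik enum_valP.
by [].
Qed.

Lemma psubmx_nonneg (C : numClosedFieldType) (m : nat) (A : 'M[C]_m)
    (U : {set 'I_m}) : nonneg_mx A -> nonneg_mx (psubmx A U).
Proof. by move=> HA i j; rewrite mxE. Qed.

Lemma psubmx_mul (C : numClosedFieldType) (m : nat) (A : 'M[C]_m)
    (U : {set 'I_m}) (x : 'cV[C]_m) (k : 'I_#|U|) :
  (psubmx A U *m restrict_vec U x) k 0 = \sum_(j in U) A (enum_val k) j * x j 0.
Proof.
rewrite big_enum_val mulmx_colE; apply: eq_bigr => j _.
by rewrite !mxE.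
Qed.

(** Hypothesizing on products covers both vectors supported in [U] and rows whose edges leaving [U]
    miss the support of [x]. *)
Lemma psubmx_mul_eq (C : numClosedFieldType) (m : nat) (A : 'M[C]_m)
    (U : {set 'I_m}) (x : 'cV[C]_m) (k : 'I_#|U|) :
  (forall j, j \notin U -> A (enum_val k) j * x j 0 = 0) ->
  (psubmx A U *m restrict_vec U x) k 0 = (A *m x) (enum_val k) 0.
Proof.
move=> H; rewrite psubmx_mul mulmx_colE [RHS](bigID (mem U)) /=.
by rewrite [X in _ = _ + X]big1 ?addr0.
Qed.

Lemma psubmx_mul_le (C : numClosedFieldType) (m : nat) (A : 'M[C]_m)
    (U : {set 'I_m}) (x : 'cV[C]_m) (k : 'I_#|U|) :
  nonneg_mx A -> nonneg_vec x ->
  (psubmx A U *m restrict_vec U x) k 0 <= (A *m x) (enum_val k) 0.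
Proof.
move=> HA Hx; rewrite psubmx_mul mulmx_colE [leRHS](bigID (mem U)) /= lerDl.
by apply: sumr_ge0 => j _; apply: mulr_ge0.
Qed.

Lemma psubmx_mul_lt (C : numClosedFieldType) (m : nat) (A : 'M[C]_m)
    (U : {set 'I_m}) (x : 'cV[C]_m) (k : 'I_#|U|) (j : 'I_m) :
  nonneg_mx A -> pos_vec x -> j \notin U -> 0 < A (enum_val k) j ->
  (psubmx A U *m restrict_vec U x) k 0 < (A *m x) (enum_val k) 0.
Proof.
move=> HA Hx jU Akj; rewrite psubmx_mul mulmx_colE [ltRHS](bigID (mem U)) /= ltrDl.
rewrite (bigD1 j) //= ltr_pwDl ?mulr_gt0 //.
by apply: sumr_ge0 => i _; rewrite mulr_ge0 // ltW.
Qed.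

(** A strict supersolution of A at l > rho(A) restricts to a supersolution of A[U]; l is arbitrary
    above rho(A). *)
Lemma spec_rad_psubmx_le (C : numClosedFieldType) (m : nat) (A : 'M[C]_m)
    (U : {set 'I_m}) : nonneg_mx A -> U != set0 ->
  spec_rad (psubmx A U) <= spec_rad A.
Proof.
move=> HA U0; have U1 : (0 < #|U|)%N by rewrite card_gt0.
have m0 : (0 < m)%N by rewrite -[m]card_ord (leq_trans U1) // max_card.
have [_ r0 _ H] := spec_rad_perron m0 HA.
apply: real_le_forall_gt; rewrite ?ger0_real ?spec_rad_ge0 //.
  exact: psubmx_nonneg.
move=> l /H[x [Hx Hl]].
apply: (@spec_rad_le_super _ _ _ (restrict_vec U x)) => //.
- exact: psubmx_nonneg.
- by move=> k; rewrite mxE.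
move=> k; rewrite [restrict_vec U x k 0]mxE; apply: le_trans (ltW (Hl _)).
by apply: psubmx_mul_le => // i; apply: ltW.
Qed.

(** * Strongly connected components as reachability classes *)

Definition edge (C : numClosedFieldType) (m : nat) (A : 'M[C]_m) : rel 'I_m :=
  [rel i j | 0 < A i j].

Definition scc_of (C : numClosedFieldType) (m : nat) (A : 'M[C]_m) (i : 'I_m) :
    {set 'I_m} :=
  [set j | connect (edge A) i j && connect (edge A) j i].

Lemma scc_of_refl (C : numClosedFieldType) (m : nat) (A : 'M[C]_m) (i : 'I_m) :
  i \in scc_of A i.
Proof. by rewrite inE !connect0. Qed.

Lemma scc_of_eq (C : numClosedFieldType) (m : nat) (A : 'M[C]_m) (i j : 'I_m) :
  j \in scc_of A i -> scc_of A j = scc_of A i.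
Proof.
rewrite inE => /andP[ij ji]; apply/setP => k; rewrite !inE.
apply/andP/andP => -[a b]; split.
- exact: connect_trans ij a.
- exact: connect_trans b ji.
- exact: connect_trans ji a.
- exact: connect_trans b ij.
Qed.

(** A path of the whole digraph between two members stays in the class: each of its vertices is
    reachable from [i] and reaches [i]. *)
Lemma scc_of_connected (C : numClosedFieldType) (m : nat) (A : 'M[C]_m) (i : 'I_m) :
  strongly_connected_on A (scc_of A i).
Proof.
move=> j k ji ki; have jk : connect (edge A) j k.
  move: ji ki; rewrite !inE => /andP[_ ji] /andP[ik _].
  exact: connect_trans ji ik.
case/connectP: jk => p; elim: p j ji => [|l p IH] j ji /=.
  by move=> _ ->; apply: connect0.
case/andP=> jl lp kE; have li : l \in scc_of A i.
  move: ji ki; rewrite !inE => /andP[ij _] /andP[_ ki].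
  have lk : connect (edge A) l k by apply/connectP; exists p.
  by rewrite (connect_trans ij (connect1 jl)) (connect_trans lk ki).
apply: (connect_trans _ (IH l li lp kE)); apply: connect1.
by rewrite /edge_in /= ji li.
Qed.

Lemma connect_edge_in (C : numClosedFieldType) (m : nat) (A : 'M[C]_m)
    (W : {set 'I_m}) (i j : 'I_m) :
  connect (edge_in A W) i j -> connect (edge A) i j.
Proof.
by apply: connect_sub => a b /andP[_ ab]; apply: connect1.
Qed.

Lemma strongly_connected_sub_scc_of (C : numClosedFieldType) (m : nat)
    (A : 'M[C]_m) (W : {set 'I_m}) (i : 'I_m) :
  strongly_connected_on A W -> i \in W -> W \subset scc_of A i.
Proof.
move=> HW iW; apply/subsetP => j jW.
by rewrite inE !(@connect_edge_in _ _ _ W) // HW.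
Qed.

Lemma scc_of_scc (C : numClosedFieldType) (m : nat) (A : 'M[C]_m) (i : 'I_m) :
  is_scc A (scc_of A i).
Proof.
split; first by apply/set0Pn; exists i; apply: scc_of_refl.
split; first exact: scc_of_connected.
move=> W sW HW; apply/eqP; rewrite eqEsubset sW andbT.
apply: strongly_connected_sub_scc_of HW _.
by apply: (subsetP sW); apply: scc_of_refl.
Qed.

Lemma scc_scc_of (C : numClosedFieldType) (m : nat) (A : 'M[C]_m)
    (V : {set 'I_m}) (i : 'I_m) : is_scc A V -> i \in V -> V = scc_of A i.
Proof.
move=> [_ [HV maxV]] iV; apply/esym/maxV; last exact: scc_of_connected.
exact: strongly_connected_sub_scc_of.
Qed.

(** Each vertex lies in its own component, so an edge leaving the class is an edge to another
    component. *)
Lemma is_sinkP (C : numClosedFieldType) (m : nat) (A : 'M[C]_m) (i : 'I_m) :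
  is_sink A (scc_of A i) <->
  (forall a b, a \in scc_of A i -> 0 < A a b -> b \in scc_of A i).
Proof.
split=> [H a b ai Aab|H W HW WV].
  have [bV|bV] := eqVneq (scc_of A b) (scc_of A i).
    by rewrite -bV scc_of_refl.
  have := H _ (scc_of_scc A b) bV => /existsP[]; exists a; rewrite ai /=.
  by apply/existsP; exists b; rewrite scc_of_refl.
apply/negP => /existsP[a /andP[ai /existsP[b /andP[bW Aab]]]].
have bi := H a b ai Aab; move: WV.
by rewrite (scc_scc_of HW bW) (scc_of_eq bi) eqxx.
Qed.

Lemma is_sourceP (C : numClosedFieldType) (m : nat) (A : 'M[C]_m) (i : 'I_m) :
  is_source A (scc_of A i) <->
  (forall a b, b \in scc_of A i -> 0 < A a b -> a \in scc_of A i).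
Proof.
split=> [H a b bi Aab|H W HW WV].
  have [aV|aV] := eqVneq (scc_of A a) (scc_of A i).
    by rewrite -aV scc_of_refl.
  have := H _ (scc_of_scc A a) aV => /existsP[]; exists a; rewrite scc_of_refl /=.
  by apply/existsP; exists b; rewrite bi.
apply/negP => /existsP[a /andP[aW /existsP[b /andP[bi Aab]]]].
have ai := H a b bi Aab; move: WV.
by rewrite (scc_scc_of HW aW) (scc_of_eq ai) eqxx.
Qed.

(** A path inside [V] from any vertex to a point of [Y] is followed backwards from its end. *)
Lemma strongly_connected_pred_closed (C : numClosedFieldType) (m : nat)
    (A : 'M[C]_m) (V Y : {set 'I_m}) :
  strongly_connected_on A V -> Y \subset V -> Y != set0 ->
  (forall i j, i \in V -> j \in Y -> 0 < A i j -> i \in Y) -> Y = V.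
Proof.
move=> HV YV /set0Pn[y yY] Yc; apply/eqP; rewrite eqEsubset YV.
apply/subsetP => i iV; have := HV _ _ iV (subsetP YV _ yY).
case/connectP=> p; elim: p i {iV} => [|l p IH] i /=; first by move=> _ <-.
case/andP=> /andP[/andP[iV lV] Ail] lp yE.
by apply: (Yc _ l) => //; apply: IH.
Qed.

Lemma irreducible_mx_trivial (C : numClosedFieldType) (m : nat) (A : 'M[C]_m) :
  irreducible_mx A -> pred_closed_trivial A.
Proof.
move=> HA Y Y0 Yc; apply: strongly_connected_pred_closed HA _ Y0 _.
  exact: subsetT.
by move=> i j _; apply: Yc.
Qed.

Lemma psubmx_trivial (C : numClosedFieldType) (m : nat) (A : 'M[C]_m)
    (V : {set 'I_m}) :
  strongly_connected_on A V -> pred_closed_trivial (psubmx A V).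
Proof.
move=> HV Y Y0 Yc; have YV : enum_val @: Y = V.
  apply: strongly_connected_pred_closed HV _ _ _.
  - by apply/subsetP => _ /imsetP[k _ ->]; apply: enum_valP.
  - by rewrite imset_eq0.
  move=> i j iV /imsetP[k kY ->] Aik; apply/imsetP.
  exists (enum_rank_in iV i); last by rewrite enum_rankK_in.
  by apply: (Yc _ k) => //; rewrite mxE enum_rankK_in.
apply/setP => k; rewrite inE.
have /setP/(_ (enum_val k)) := YV; rewrite enum_valP.
by case/imsetP=> l lY /enum_val_inj->.
Qed.

(** Take [i] with the fewest elements of [Y] above it: if [r i j], those above [j] are among those
    above [i] and as many, so [i] is one of them. *)
Lemma preorder_maximal (T : finType) (r : rel T) (Y : {set T}) :
  reflexive r -> transitive r -> Y != set0 ->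
  exists2 i, i \in Y & forall j, j \in Y -> r i j -> r j i.
Proof.
move=> rr rt /set0Pn[y yY]; pose f i := #|[set j in Y | r i j]|.
case: (@arg_minnP _ y (mem Y) f yY) => i iY Hi; exists i => // j jY rij.
have := Hi j jY; have S : [set k in Y | r j k] \subset [set k in Y | r i k].
  by apply/subsetP => k; rewrite !inE => /andP[-> /(rt _ _ _ rij)].
have := subset_leq_card S; rewrite -/(f i) -/(f j) => a b.
have /eqP/setP/(_ i) : [set k in Y | r j k] == [set k in Y | r i k].
  by rewrite eqEcard S.
by rewrite !inE (iY : i \in Y) rr /= => ->.
Qed.

(** * Extended-valued ratios as linear inequalities *)

Lemma bigmaxe_lee (C : numClosedFieldType) (I : finType) (F : I -> option C) (s : C) :
  0 <= s -> (forall i, lee (F i) (Some s)) -> lee (\big[@maxe C/Some 0]_i F i) (Some s).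
Proof.
move=> s0 H; elim/big_rec: _ => // i [x|] _ //; have := H i.
by case: (F i) => //= a; case: ifP.
Qed.

(** [maxe] keeps its first argument when the comparison fails; nonnegativity makes finite values
    comparable, so the result bounds both. *)
Lemma bigmaxe_Some (C : numClosedFieldType) (I : finType) (F : I -> option C) (s : C) :
  (forall i a, F i = Some a -> 0 <= a) -> \big[@maxe C/Some 0]_i F i = Some s ->
  0 <= s /\ forall i, lee (F i) (Some s).
Proof.
move=> F0 Fs; suff [s0 H] : 0 <= s /\ forall i, i \in index_enum I -> lee (F i) (Some s).
  by split=> // i; apply: H; apply: mem_index_enum.
elim: (index_enum I) s Fs => [|i e IH] s; first by rewrite big_nil => -[<-].
rewrite big_cons; case E: (F i) => [a|] //; case Ee: (bigop _ _ _) => [b|] //= [sE].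
have [b0 Hb] := IH b Ee; have a0 := F0 _ _ E.
have [aS bS] : a <= s /\ b <= s.
  rewrite -sE; case: ifP => [//|/negbT ab]; split=> //.
  by have [//|/ltW] := real_leP (ger0_real b0) (ger0_real a0); rewrite (negPf ab).
split=> [|j]; first exact: le_trans bS.
rewrite inE => /orP[/eqP->|/Hb]; first by rewrite E.
by case: (F j) => //= c cb; apply: le_trans bS.
Qed.

(** Where x_i = 0 the hypothesis forces (A x)_i = 0, and 0/0 = 0 by convention. *)
Lemma rfun_lee (C : numClosedFieldType) (m : nat) (A : 'M[C]_m) (x : 'cV[C]_m)
    (s : C) : nonneg_mx A -> nonneg_vec x -> 0 <= s ->
  (forall i, (A *m x) i 0 <= s * x i 0) -> lee (rfun A 1%:M x) (Some s).
Proof.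
move=> HA Hx s0 H; apply: bigmaxe_lee => // i; rewrite mul1mx /Defs.ratio.
have := H i; have [-> |xi] := eqVneq (x i 0) 0; last first.
  by rewrite /= ler_pdivrMr // lt_def xi Hx.
rewrite mulr0 => a0; have -> : (A *m x) i 0 = 0; last by rewrite eqxx.
by apply/le_anti; rewrite a0 nonneg_mulmx.
Qed.

(** A finite maximum rules out c/0 with c > 0, so the inequality also holds where x_i = 0. *)
Lemma rfun_SomeP (C : numClosedFieldType) (m : nat) (A : 'M[C]_m) (x : 'cV[C]_m)
    (s : C) : nonneg_mx A -> nonneg_vec x -> rfun A 1%:M x = Some s ->
  0 <= s /\ forall i, (A *m x) i 0 <= s * x i 0.
Proof.
move=> HA Hx; rewrite /rfun => /bigmaxe_Some[i a|s0 H].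
  rewrite mul1mx /Defs.ratio; case: ifP => _; first by case: ifP => // _ [<-].
  by move=> [<-]; rewrite divr_ge0 // nonneg_mulmx.
split=> // i; have := H i; rewrite mul1mx /Defs.ratio.
have [->|xi] := eqVneq (x i 0) 0.
  by case: eqP => // -> _; rewrite mulr0.
by rewrite /= ler_pdivrMr // lt_def xi Hx.
Qed.

Lemma lee_trans (C : numClosedFieldType) (a b c : option C) :
  lee a b -> lee b c -> lee a c.
Proof. by case: a b c => [a|] [b|] [c|] //=; apply: le_trans. Qed.

(** * Supersolutions and the reduced digraph *)

Lemma pos_vec_nonneg (C : numClosedFieldType) (n : nat) (x : 'cV[C]_n) :
  pos_vec x -> nonneg_vec x.
Proof. by move=> Hx i; apply: ltW. Qed.

Lemma rho_is_spec_rad (C : numClosedFieldType) (m : nat) (A : 'M[C]_m) :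
  (0 < m)%N -> nonneg_mx A -> is_infe (rho_set A 1%:M) (Some (spec_rad A)).
Proof.
move=> m0 HA; have [_ r0 _ H] := spec_rad_perron m0 HA; split.
  move=> [s|] // [x [Hx /(rfun_SomeP HA (pos_vec_nonneg Hx))[s0 Hs]]].
  exact: spec_rad_le_super Hs.
move=> w Hw; have wl l : spec_rad A < l -> lee w (Some l).
  move=> rl; have [x [Hx Hl]] := H l rl.
  apply: (@lee_trans _ _ (rfun A 1%:M x)); first by apply: Hw; exists x.
  apply: rfun_lee => //; [exact: pos_vec_nonneg|exact: le_trans (ltW rl)|].
  by move=> i; apply: ltW.
(* One value of l suffices to make [w] finite and, being below a real number, real. *)
have r1 : spec_rad A < spec_rad A + 1 by rewrite ltrDl.
case: w Hw wl (wl _ r1) => [w|] _ wl //= w1.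
apply: real_le_forall_gt => //; last exact: ger0_real.
by rewrite (ler_real w1) ger0_real // (le_trans r0) // ltW.
Qed.

(** On the class, irreducibility turns the inequality into an equality, which an edge leaving the
    class would break by a positive term. *)
Lemma min_super_sink (C : numClosedFieldType) (m : nat) (A : 'M[C]_m)
    (x : 'cV[C]_m) (i : 'I_m) : nonneg_mx A -> pos_vec x ->
  (forall j, (A *m x) j 0 <= spec_rad A * x j 0) ->
  spec_rad (psubmx A (scc_of A i)) = spec_rad A -> is_sink A (scc_of A i).
Proof.
move=> HA Hx Hr rV; apply/is_sinkP => a b aV Aab; apply/negPn/negP => bV.
set V := scc_of A i in rV aV bV *.
have V0 : (0 < #|V|)%N by rewrite card_gt0; apply/set0Pn; exists a.
have HV : nonneg_mx (psubmx A V) := psubmx_nonneg HA.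
have E : psubmx A V *m restrict_vec V x = spec_rad (psubmx A V) *: restrict_vec V x.
  apply: irreducible_super_eq => //.
    exact: psubmx_trivial (@scc_of_connected _ _ _ _).
  move=> k; rewrite rV [restrict_vec V x k 0]mxE.
  by apply: le_trans (Hr _); apply: psubmx_mul_le => //; apply: pos_vec_nonneg.
have Aab' : 0 < A (enum_val (enum_rank_in aV a)) b by rewrite enum_rankK_in.
have := psubmx_mul_lt HA Hx bV Aab'; by rewrite E rV 2!mxE le_gtF.
Qed.

(** The Perron vector of the block, extended by zero. The equation is confined to rows of the class,
    since edges entering it give nonzero values outside. *)
Lemma scc_perron (C : numClosedFieldType) (m : nat) (A : 'M[C]_m) (i : 'I_m) :
  nonneg_mx A ->
  exists x : 'cV[C]_m,
    [/\ forall a, a \in scc_of A i -> 0 < x a 0,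
        forall a, a \notin scc_of A i -> x a 0 = 0 &
        forall a, a \in scc_of A i ->
          (A *m x) a 0 = spec_rad (psubmx A (scc_of A i)) * x a 0].
Proof.
move=> HA; set V := scc_of A i.
have V0 : (0 < #|V|)%N by rewrite card_gt0; apply/set0Pn; exists i; apply: scc_of_refl.
have HV : nonneg_mx (psubmx A V) := psubmx_nonneg HA.
have [_ _ [y [y0 yn Ey]] _] := spec_rad_perron V0 HV.
have yp : pos_vec y.
  apply: (irreducible_super_pos HV _ y0 yn).
    exact: psubmx_trivial (@scc_of_connected _ _ _ _).
  by move=> k; rewrite Ey mxE; apply: lexx.
have [x xy x0] := pad_vec y; exists x; split=> // a aV.
  have := yp (enum_rank_in aV a); rewrite -xy mxE enum_rankK_in //.
rewrite -xy in Ey; have /colP/(_ (enum_rank_in aV a)) := Ey.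
rewrite psubmx_mul_eq => [|j /x0->]; last by rewrite mulr0.
by rewrite 2![in RHS]mxE enum_rankK_in.
Qed.

(* A class of the support of a Perron vector of A[T] from which no other class of
   the support is reachable already carries the whole spectral radius of A[T]. *)
Lemma spec_rad_psubmx_class (C : numClosedFieldType) (m : nat) (A : 'M[C]_m)
    (T : {set 'I_m}) : nonneg_mx A -> T != set0 ->
  (forall i, i \in T -> scc_of A i \subset T) ->
  exists2 i, i \in T & spec_rad (psubmx A T) <= spec_rad (psubmx A (scc_of A i)).
Proof.
move=> HA T0 Tc; have T1 : (0 < #|T|)%N by rewrite card_gt0.
have [_ r0 [z [z0 zn Ez]] _] := spec_rad_perron T1 (psubmx_nonneg (U := T) HA).
set r := spec_rad (psubmx A T) in r0 Ez *.
have [y yz y0] := pad_vec z.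
have yge j : 0 <= y j 0.
  have [jT|/y0->//] := boolP (j \in T).
  by have := z0 (enum_rank_in jT j); rewrite -yz mxE enum_rankK_in.
have Ey a : a \in T -> (A *m y) a 0 = r * y a 0.
  move=> aT; rewrite -yz in Ez; have /colP/(_ (enum_rank_in aT a)) := Ez.
  rewrite psubmx_mul_eq => [|j /y0->]; last by rewrite mulr0.
  by rewrite 2![in RHS]mxE enum_rankK_in.
pose Y := [set j | y j 0 != 0].
have Y0 : Y != set0.
  apply: contraNneq zn => /setP YE; apply/eqP/colP => k; rewrite -yz !mxE.
  by have := YE (enum_val k); rewrite !inE => /negbFE/eqP.
have [i iY Hi] := @preorder_maximal _ (connect (edge A)) Y (connect0 _)
  (@connect_trans _ _) Y0.
have iT : i \in T by apply: contraLR iY => /y0 yi; rewrite inE yi eqxx.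
exists i => //; set V := scc_of A i.
have V1 : (0 < #|V|)%N by rewrite card_gt0; apply/set0Pn; exists i; apply: scc_of_refl.
apply: (@eigenvalue_le_spec_rad _ _ _ (restrict_vec V y)) => //.
- exact: psubmx_nonneg.
- move: iY; rewrite inE; apply: contraNneq => /colP/(_ (enum_rank_in (scc_of_refl A i) i)).
  by rewrite !mxE enum_rankK_in ?scc_of_refl // => ->.
apply/colP => k; have kV := enum_valP k.
rewrite psubmx_mul_eq => [|j jV].
  by rewrite Ey ?mxE //; apply: (subsetP (Tc i iT)).
(* A vertex [j] of the support entered from [V] is reachable from [i], so by the choice of [i] it
   also reaches [i] and lies in [V]. *)
apply/eqP; apply: contraNT jV; rewrite mulf_eq0 negb_or => /andP[Aj yj].
have ij : connect (edge A) i j.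
  move: kV; rewrite inE => /andP[ik _]; apply: (connect_trans ik).
  by apply: connect1; rewrite /edge /= lt_def Aj HA.
by rewrite inE ij Hi // inE.
Qed.

Lemma exists_min_super (C : numClosedFieldType) (m : nat) (A : 'M[C]_m) :
  (0 < m)%N -> nonneg_mx A ->
  (forall i, spec_rad (psubmx A (scc_of A i)) = spec_rad A ->
     is_sink A (scc_of A i)) ->
  exists2 x : 'cV[C]_m, pos_vec x &
    forall i, (A *m x) i 0 <= spec_rad A * x i 0.
Proof.
move=> m0 HA Hsink; have r0 := spec_rad_ge0 m0 HA; set r := spec_rad A in r0 Hsink *.
pose T := [set i | spec_rad (psubmx A (scc_of A i)) != r].
have NT i : i \notin T -> spec_rad (psubmx A (scc_of A i)) = r.
  by rewrite inE negbK => /eqP.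
have /fin_all_exists[f Hf] : forall V : {set 'I_m}, exists x : 'cV[C]_m,
    [exists i, scc_of A i == V] ->
    (forall a, a \in V -> 0 < x a 0) /\
    (forall a, a \in V -> (A *m x) a 0 = spec_rad (psubmx A V) * x a 0).
  move=> V; have [/existsP[i /eqP<-]|_] := boolP [exists i, scc_of A i == V].
    by have [x [? _ ?]] := scc_perron i HA; exists x.
  by exists 0.
have sccP i : [exists j, scc_of A j == scc_of A i] by apply/existsP; exists i.
have {}Hf i := Hf (scc_of A i) (sccP i).
have Tc i j : j \in scc_of A i -> (j \in T) = (i \in T).
  by move=> ji; rewrite !inE (scc_of_eq ji).
have out i j : i \notin T -> 0 < A i j -> j \in scc_of A i.
  move=> iT; have /is_sinkP := Hsink i (NT i iT); apply.
  exact: scc_of_refl.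
(* Perron vectors of the maximal classes side by side; they do not interact, as no edge leaves these
   classes. *)
pose xS : 'cV[C]_m := \col_i (if i \in T then 0 else f (scc_of A i) i 0).
have xS0 i : 0 <= xS i 0.
  rewrite mxE; case: ifP => // _; apply/ltW; have [+ _] := Hf i.
  by apply; apply: scc_of_refl.
have ES i : i \notin T -> (A *m xS) i 0 = r * xS i 0.
  move=> iT; have [_ /(_ i (scc_of_refl A i))] := Hf i.
  rewrite NT // [xS i 0]mxE (negPf iT) => <-; rewrite !mulmx_colE.
  apply: eq_bigr => j _; have [Aij|] := boolP (0 < A i j).
    have ji := out i j iT Aij.
    by rewrite mxE (Tc i j ji) (negPf iT) (scc_of_eq ji).
  by rewrite lt_def HA andbT negbK => /eqP->; rewrite !mul0r.
have [TE|T0] := eqVneq T set0.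
  exists xS => i; last by rewrite ES // TE inE.
  rewrite mxE TE inE; have [+ _] := Hf i; apply; exact: scc_of_refl.
(* The radius of A[T] is at most that of a class inside [T], which differs from r and is at most
   r. *)
have rT : spec_rad (psubmx A T) < r.
  have [|i iT Hi] := spec_rad_psubmx_class HA T0.
    by move=> i iT; apply/subsetP => j /Tc->.
  apply: le_lt_trans Hi _; rewrite lt_neqAle; apply/andP; split.
    by move: iT; rewrite inE.
  by apply: spec_rad_psubmx_le => //; apply/set0Pn; exists i; apply: scc_of_refl.
have T1 : (0 < #|T|)%N by rewrite card_gt0.
have [_ _ _ /(_ r rT)[z [zp Hz]]] := spec_rad_perron T1 (psubmx_nonneg (U := T) HA).
have [y yz y0] := pad_vec z.
have yT i : i \in T -> 0 < y i 0.
  by move=> iT; have := zp (enum_rank_in iT i); rewrite -yz mxE enum_rankK_in.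
have Ey i : i \in T -> 0 < r * y i 0 - (A *m y) i 0.
  move=> iT; have := Hz (enum_rank_in iT i); rewrite -yz.
  rewrite psubmx_mul_eq => [|j /y0->]; last by rewrite mulr0.
  by rewrite [restrict_vec T y _ 0]mxE enum_rankK_in // subr_gt0.
have EyN i : i \notin T -> (A *m y) i 0 = 0.
  move=> iT; rewrite mulmx_colE big1 // => j _.
  have [Aij|] := boolP (0 < A i j).
    by rewrite y0 ?mulr0 // (Tc i j) // out.
  by rewrite lt_def HA andbT negbK => /eqP->; rewrite mul0r.
(* The multiple of [y] whose slack in row [i] absorbs the contribution of [xS]; [t] exceeds all of
   these and is positive. *)
pose c i := if i \in T then (A *m xS) i 0 / (r * y i 0 - (A *m y) i 0) else 0.
have c0 i : 0 <= c i.
  rewrite /c; case: ifP => // iT; apply: divr_ge0; last exact/ltW/Ey.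
  exact: nonneg_mulmx.
pose t := 1 + \sum_i c i.
have t0 : 0 < t by rewrite ltr_pwDl // sumr_ge0.
have ct i : c i <= t.
  rewrite /t (bigD1 i) //= addrCA lerDl addr_ge0 // sumr_ge0 //.
exists (xS + t *: y) => i.
  rewrite mxE [(t *: y) i 0]mxE; have [iT|iT] := boolP (i \in T).
    by rewrite ltr_wpDl // mulr_gt0 // yT.
  rewrite y0 // mulr0 addr0 mxE (negPf iT); have [+ _] := Hf i; apply.
  exact: scc_of_refl.
rewrite mulmxDr -scalemxAr mxE [(xS + t *: y) i 0]mxE [(t *: y) i 0]mxE.
rewrite [(t *: (A *m y)) i 0]mxE; have [iT|iT] := boolP (i \in T); last first.
  by rewrite ES // EyN // y0 // !mulr0 !addr0.
have -> : xS i 0 = 0 by rewrite mxE iT.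
have := ct i; rewrite /c iT ler_pdivrMr ?Ey // mulrBr lerBrDr add0r.
by rewrite [t * (r * _)]mulrCA.
Qed.

(** A class of the support reached from no other class of the support is a source, and there [x]
    restricts to a positive supersolution. *)
Lemma super_source_le (C : numClosedFieldType) (m : nat) (A : 'M[C]_m)
    (x : 'cV[C]_m) (s : C) : nonneg_mx A -> nonneg_vec x -> x != 0 ->
  (forall i, (A *m x) i 0 <= s * x i 0) ->
  exists2 i, is_source A (scc_of A i) & spec_rad (psubmx A (scc_of A i)) <= s.
Proof.
move=> HA Hx x0 Hs; pose Y := [set j | x j 0 != 0].
have Y0 : Y != set0.
  apply: contraNneq x0 => /setP YE; apply/eqP/colP => k; rewrite mxE.
  by have := YE k; rewrite !inE => /negbFE/eqP.
have Yc i j : connect (edge A) i j -> j \in Y -> i \in Y.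
  case/connectP=> p; elim: p i => [|l p IH] i /=; first by move=> _ ->.
  case/andP=> Ail lp jE jY; have := IH l lp jE jY; rewrite !inE.
  exact: (nonneg_super_support HA Hx Hs Ail).
(* Reachability is reversed: whatever in [Y] reaches [i] is reached from [i]. *)
have [|i iY Hi] := @preorder_maximal _ (fun a b => connect (edge A) b a) Y
  (connect0 _) _ Y0.
  by move=> a b c ba cb; apply: (connect_trans cb ba).
have src a b : b \in scc_of A i -> 0 < A a b -> a \in scc_of A i.
  rewrite !inE => /andP[_ bi] Aab.
  have ai : connect (edge A) a i by apply: (connect_trans _ bi); apply: connect1.
  by rewrite ai andbT; apply: Hi => //; apply: Yc iY.
exists i; first exact/is_sourceP.
set V := scc_of A i.
have V1 : (0 < #|V|)%N by rewrite card_gt0; apply/set0Pn; exists i; apply: scc_of_refl.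
apply: (@spec_rad_le_super _ _ _ (restrict_vec V x)) => //.
- exact: psubmx_nonneg.
- move=> k; rewrite mxE lt_def Hx andbT.
  suff : enum_val k \in Y by rewrite inE.
  by apply: Yc iY; have := enum_valP k; rewrite inE => /andP[].
move=> k; rewrite [restrict_vec V x k 0]mxE; apply: le_trans (Hs _).
exact: psubmx_mul_le.
Qed.

(** No edge enters a source class, so in rows outside it A w vanishes along with w. *)
Lemma source_eigenvector (C : numClosedFieldType) (m : nat) (A : 'M[C]_m)
    (i : 'I_m) : nonneg_mx A -> is_source A (scc_of A i) ->
  exists w : 'cV[C]_m, nonneg_vec w /\ w != 0 /\
    A *m w = spec_rad (psubmx A (scc_of A i)) *: w.
Proof.
move=> HA /is_sourceP src; have [w [wp w0 Ew]] := scc_perron i HA.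
exists w; split=> [a|].
  by have [/wp/ltW//|/w0->] := boolP (a \in scc_of A i).
split.
  by apply: contraTneq (wp i (scc_of_refl A i)) => ->; rewrite mxE ltxx.
apply/colP => a; rewrite [RHS]mxE.
have [/Ew//|aV] := boolP (a \in scc_of A i).
rewrite w0 // mulr0 mulmx_colE big1 // => b _.
have [bV|/w0->] := boolP (b \in scc_of A i); last by rewrite mulr0.
have [->|Aab] := eqVneq (A a b) 0; first by rewrite mul0r.
by move: aV; rewrite (src a b) // lt_def Aab HA.
Qed.

(** Each finite ratio bounds the radius of some source class from above; the eigenvector of the
    minimizing source class attains that bound. *)
Lemma rhohat_source (C : numClosedFieldType) (m : nat) (A : 'M[C]_m) :
  (0 < m)%N -> nonneg_mx A ->
  exists2 i, is_source A (scc_of A i) &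
    (forall j, is_source A (scc_of A j) ->
       spec_rad (psubmx A (scc_of A i)) <= spec_rad (psubmx A (scc_of A j))) /\
    is_infe (rhohat_set A 1%:M) (Some (spec_rad (psubmx A (scc_of A i)))).
Proof.
move=> m0 HA.
pose src i := [forall a, forall b, (b \in scc_of A i) ==> (0 < A a b) ==>
  (a \in scc_of A i)].
have srcP i : src i <-> is_source A (scc_of A i).
  split=> [H|/is_sourceP H]; last first.
    apply/forallP => a; apply/forallP => b; apply/implyP => bi; apply/implyP => Aab.
    exact: H bi Aab.
  apply/is_sourceP => a b bi Aab.
  by have /forallP/(_ a)/forallP/(_ b)/implyP/(_ bi)/implyP := H; apply.
have [_ _ [y [y0 yn Ay]] _] := spec_rad_perron m0 HA.
(* A Perron vector of A serves here only to produce some source. *)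
have [|i0 /srcP src0 _] := super_source_le HA y0 yn (s := spec_rad A).
  by move=> i; rewrite Ay mxE; apply: lexx.
pose v i := spec_rad (psubmx A (scc_of A i)).
have v0 i : 0 <= v i.
  apply: spec_rad_ge0; last exact: psubmx_nonneg.
  by rewrite card_gt0; apply/set0Pn; exists i; apply: scc_of_refl.
have [i /srcP si Hi] := @fin_real_min C _ src v i0 src0 (fun i => ger0_real (v0 i)).
exists i => //; split=> [j /srcP/Hi//|]; split.
  move=> [s|] // [x [Hx [x0 /(rfun_SomeP HA Hx)[s0 Hs]]]].
  have [j /srcP sj js] := super_source_le HA Hx x0 Hs.
  exact: le_trans (Hi j sj) js.
have [w [w0 [wn Ew]]] := source_eigenvector HA si.
move=> u Hu; apply: (@lee_trans _ _ (rfun A 1%:M w)).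
  by apply: Hu; exists w.
by apply: (rfun_lee HA w0 (v0 i)) => j; rewrite Ew mxE; apply: lexx.
Qed.

Theorem theorem3p2 (C : numClosedFieldType) (m : nat) (Hm : (0 < m)%N)
    (A : 'M[C]_m) (HA : nonneg_mx A) :
  (* (1) *)
  (is_infe (rho_set A 1%:M) (Some (spec_rad A)) /\
   exists y : 'cV[C]_m, nonneg_vec y /\ y != 0 /\ A *m y = spec_rad A *: y) /\
  (* (2) *)
  ((exists x : 'cV[C]_m, pos_vec x /\ rfun A 1%:M x = Some (spec_rad A)) <->
   (forall V, is_scc A V -> spec_rad (psubmx A V) = spec_rad A -> is_sink A V)) /\
  (* (3) *)
  (irreducible_mx A ->
   forall x1 x2 : 'cV[C]_m,
     pos_vec x1 -> \sum_i x1 i 0 = 1 -> rfun A 1%:M x1 = Some (spec_rad A) ->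
     pos_vec x2 -> \sum_i x2 i 0 = 1 -> rfun A 1%:M x2 = Some (spec_rad A) ->
     x1 = x2) /\
  (* (4) *)
  (exists v : C,
     ((exists V, is_scc A V /\ is_source A V /\ spec_rad (psubmx A V) = v) /\
      (forall V, is_scc A V -> is_source A V -> v <= spec_rad (psubmx A V))) /\
     is_infe (rhohat_set A 1%:M) (Some v) /\
     exists w : 'cV[C]_m, nonneg_vec w /\ w != 0 /\ A *m w = v *: w).
Proof.
have scc_in V : is_scc A V -> exists i, V = scc_of A i.
  by move=> HV; have [/set0Pn[i iV] _] := HV; exists i; apply: scc_scc_of.
have super x : pos_vec x -> rfun A 1%:M x = Some (spec_rad A) ->
    forall i, (A *m x) i 0 <= spec_rad A * x i 0.
  by move=> Hx /(rfun_SomeP HA (pos_vec_nonneg Hx))[].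
split; [|split; [|split]].
- split; first exact: rho_is_spec_rad.
  by have [_ _ [y [? ? ?]] _] := spec_rad_perron Hm HA; exists y.
- split=> [[x [Hx /(super x Hx) Hr]] V /scc_in[i ->]|Hsink].
    exact: min_super_sink Hr.
  have [|x Hx Hr] := exists_min_super Hm HA.
    by move=> i; apply: Hsink; apply: scc_of_scc.
  exists x; split=> //.
  (* The supersolution gives r(A,I,x) <= rho(A); the infimum in (1) gives the reverse. *)
  have [lb _] := rho_is_spec_rad Hm HA.
  have := lb (rfun A 1%:M x) (ex_intro _ x (conj Hx erefl)).
  have := rfun_lee HA (pos_vec_nonneg Hx) (spec_rad_ge0 Hm HA) Hr.
  case: (rfun A 1%:M x) => //= s a b.
  by congr Some; apply/le_anti; rewrite a b.
- move=> irr x1 x2 H1 s1 /(super _ H1) r1 H2 s2 /(super _ H2) r2.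
  have irr' := irreducible_mx_trivial irr.
  (* Irreducibility makes both vectors eigenvectors, hence proportional; the common sum 1 fixes the
     factor. *)
  have [t tE] := irreducible_eigenvector_unique Hm HA irr' H1 H2
    (irreducible_super_eq Hm HA irr' r1) (irreducible_super_eq Hm HA irr' r2).
  suff t1 : t = 1 by rewrite tE t1 scale1r.
  rewrite -s1 tE -[LHS]mulr1 -s2 mulr_sumr.
  by apply: eq_bigr => i _; rewrite mxE.
have [i si [Hi inf]] := rhohat_source Hm HA.
exists (spec_rad (psubmx A (scc_of A i))); split; last first.
  by split=> //; apply: source_eigenvector.
split; first by exists (scc_of A i); split; [apply: scc_of_scc|].
by move=> V /scc_in[j ->]; apply: Hi.
Qed.
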